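(* Let $1\le p\le n$, $m,q\ge1$, $A\in\mathcal M_{m\times n}(\mathbb R)$, $B\in\mathcal M_{m\times q}(\mathbb R)$ and $C\in\mathcal M_{p\times q}(\mathbb R)$. A matrix $U\in St^n_p$ is a critical point of the Penrose regression cost function $\widetilde G:St^n_p\to\mathbb R$, $\widetilde G(U)=\frac12\|AUC-B\|^2$, if and only if: (i) the matrix $C(AUC-B)^TAU$ is symmetric; (ii) $(\mathbb I_n-UU^T)A^T(AUC-B)C^T=\mathbf 0$.
   Context: $St_p^n=\{U\in\mathcal M_{n\times p}(\mathbb R)\mid U^TU=\mathbb I_p\}$ is the orthogonal Stiefel manifold and $\|\cdot\|$ is the Frobenius norm. *)

(* Defs.v *)
From HB Require Import structures.
From mathcomp Require Import all_boot all_order all_algebra.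
From mathcomp Require Import all_classical all_reals all_analysis.

Set Implicit Arguments.
Unset Strict Implicit.
Unset Printing Implicit Defensive.

Import Order.TTheory GRing.Theory Num.Theory.
Import numFieldNormedType.Exports.

Local Open Scope classical_set_scope.
Local Open Scope ring_scope.

Definition stiefel (R : realType) (n p : nat) : set 'M[R]_(n, p) :=
  [set U | U^T *m U = 1%:M].

(* The library's norm on matrices is the sup norm, hence this definition. *)
Definition frobenius_norm (R : realType) (m q : nat) (M : 'M[R]_(m, q)) : R :=
  Num.sqrt (\sum_(i < m) \sum_(j < q) M i j ^+ 2).

Definition penrose_cost (R : realType) (m n p q : nat)
    (A : 'M[R]_(m, n)) (B : 'M[R]_(m, q)) (C : 'M[R]_(p, q))
    (U : 'M[R]_(n, p)) : R :=
  2^-1 * frobenius_norm (A *m U *m C - B) ^+ 2.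

(* g restricts to a C^oo curve ]-e, e[ -> S; the values of g outside ]-e, e[
   are irrelevant. *)
Definition smooth_curve_in (R : realType) (n p : nat)
    (S : set 'M[R]_(n, p)) (e : R) (g : R -> 'M[R]_(n, p)) : Prop :=
  forall t : R, `|t| < e -> S (g t) /\ forall k : nat, derivable (derive1n k g) t 1.

(* Critical point of the restriction of f to an embedded submanifold S, i.e.
   d(f|S)(U) = 0 on T_U S: the tangent vectors are the velocities g'(0) of the
   smooth curves g in S through U, and d(f|S)(U) maps g'(0) to (f o g)'(0).
   Only the values of f on S matter. *)
Definition critical_point_on (R : realType) (n p : nat)
    (S : set 'M[R]_(n, p)) (f : 'M[R]_(n, p) -> R) (U : 'M[R]_(n, p)) : Prop :=
  S U /\
  forall (e : R) (g : R -> 'M[R]_(n, p)),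
    0 < e -> smooth_curve_in S e g -> g 0 = U ->
    is_derive (0 : R) (1 : R) (f \o g) (0 : R).

(* Main.v *)
Require Import Defs.
From HB Require Import structures.
From mathcomp Require Import all_boot all_order all_algebra.
From mathcomp Require Import all_classical all_reals all_analysis.
From mathcomp Require Import ring.

(** Let [G = A^T (A U C - B) C^T] be the Euclidean gradient at [U].  Along a
    curve [g] through [U] the cost has derivative [tr (G^T g'(0))].  If [g]
    stays in the Stiefel manifold then [U^T g'(0)] is skew-symmetric, whereas
    (i) and (ii) say that [G = U S] with [S = U^T G] symmetric, so that
    derivative is the trace of a symmetric times a skew-symmetric matrix,
    which vanishes.  Conversely, it suffices to rotate [U] in the coordinate
    planes: for [W = E_ij - E_ji] one has [W^3 = - W], so Rodrigues' formula
    [1 + sin t W + (1 - cos t) W^2] is a curve of orthogonal matrices with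
    velocity [W] at [0], and criticality along these rotations says
    that [U G^T] is symmetric; as [U^T U = 1], this gives (i) and (ii). *)

Set Implicit Arguments.
Unset Strict Implicit.
Unset Printing Implicit Defensive.

Import Order.TTheory GRing.Theory Num.Theory.
Import numFieldNormedType.Exports.

Local Open Scope ring_scope.

(** * Entrywise differentiation of matrix-valued functions *)

Section MatrixDerivative.
Variables (R : realFieldType) (V : normedModType R).
Implicit Types (x v : V).

Lemma is_derive_mxP m n (M : V -> 'M[R]_(m, n)) x v X :
  is_derive x v M X <->
  forall i j, is_derive x v (fun t => M t i j) (X i j).
Proof.
split=> [[dM <-] i j|dM].
  rewrite derive_mx // mxE; apply: derivableP.
  by move/derivable_mxP: dM; exact.
have dvM : derivable M x v by apply/derivable_mxP => i j; case: (dM i j).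
apply: DeriveDef => //; rewrite derive_mx //.
by apply/matrixP => i j; rewrite mxE; case: (dM i j).
Qed.

Lemma is_derive_bigsum n (h : 'I_n -> V -> R) x v (dh : 'I_n -> R) :
  (forall i, is_derive x v (h i) (dh i)) ->
  is_derive x v (fun t => \sum_i h i t) (\sum_i dh i).
Proof.
move=> dhi; rewrite (_ : (fun t => _) = \sum_i h i); first exact: is_derive_sum.
by apply/funext => t; rewrite fct_sumE.
Qed.

Lemma is_derive_mulmx m n p (M : V -> 'M[R]_(m, n)) (N : V -> 'M[R]_(n, p))
    x v X Y :
  is_derive x v M X -> is_derive x v N Y ->
  is_derive x v (fun t => M t *m N t) (X *m N x + M x *m Y).
Proof.
move=> /is_derive_mxP dM /is_derive_mxP dN; apply/is_derive_mxP => i j.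
rewrite (_ : (fun t => _) = fun t => \sum_k M t i k * N t k j); last first.
  by apply/funext => t; rewrite mxE.
rewrite !mxE -big_split /=; apply: is_derive_bigsum => k.
have dMN := is_deriveM (dM i k) (dN k j).
by apply: (is_derive_eq dMN); rewrite /GRing.scale /=; ring.
Qed.

Lemma is_derive_trmx m n (M : V -> 'M[R]_(m, n)) x v X :
  is_derive x v M X -> is_derive x v (fun t => (M t)^T) X^T.
Proof.
move=> /is_derive_mxP dM; apply/is_derive_mxP => i j.
rewrite mxE (_ : (fun t => _) = fun t => M t j i) //.
by apply/funext => t; rewrite mxE.
Qed.

Lemma is_derive_mxtrace n (M : V -> 'M[R]_n) x v X :
  is_derive x v M X -> is_derive x v (fun t => \tr (M t)) (\tr X).
Proof. by move=> /is_derive_mxP dM; apply: is_derive_bigsum => i. Qed.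

End MatrixDerivative.

(** * Smooth curves that are affine in cosine and sine *)

Section TrigonometricCurve.
Variables (R : realType) (n p : nat).
Implicit Types K M N : 'M[R]_(n, p).

(** This family is closed under differentiation, which sends [(K, M, N)] to [(0, N, - M)];
    smoothness of all orders thus follows from differentiability of its members. *)
Definition trig_curve K M N (t : R) := K + (cos t *: M + sin t *: N).

Lemma is_derive_trig_curve K M N (t : R) :
  is_derive t (1 : R) (trig_curve K M N) (trig_curve 0 N (- M) t).
Proof.
apply/is_derive_mxP => i j.
rewrite (_ : (fun u => _) = cst (K i j) +
    (M i j \*: (cos : R -> R^o) + N i j \*: (sin : R -> R^o))); last first.
  apply/funext => u; rewrite !mxE !fctE.
  by congr (_ + (_ + _)); exact: mulrC.
have dcs := is_deriveD (is_deriveZ (M i j) (is_derive_cos t))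
  (is_deriveZ (N i j) (is_derive_sin t)).
apply: (is_derive_eq (is_deriveD (is_derive_cst (K i j) t 1) dcs)).
rewrite !mxE; congr (_ + _); rewrite addrC; congr (_ + _).
  by rewrite mulrN -mulNr; exact: (mulrC (M i j)).
exact: (mulrC (N i j)).
Qed.

Lemma derive1n_trig_curve K M N k :
  exists K' M' N', derive1n k (trig_curve K M N) = trig_curve K' M' N'.
Proof.
elim: k => [|k [K' [M' [N' IHk]]]]; first by exists K, M, N.
exists 0, N', (- M'); rewrite derive1nS IHk; apply/funext => t.
by rewrite derive1E; case: (is_derive_trig_curve K' M' N' t).
Qed.

Lemma derivable_derive1n_trig_curve K M N k t :
  derivable (derive1n k (trig_curve K M N)) t 1.
Proof.
have [K' [M' [N' ->]]] := derive1n_trig_curve K M N k.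
by case: (is_derive_trig_curve K' M' N' t).
Qed.

End TrigonometricCurve.

Section Rotation.
Variables (R : realType) (n p : nat) (W : 'M[R]_n).

(** Rodrigues' formula applied to [U], with the terms regrouped by [cos] and [sin] so that its
    smoothness comes from that of [trig_curve]. *)
Definition rodrigues_curve (U : 'M[R]_(n, p)) : R -> 'M[R]_(n, p) :=
  trig_curve (U + W *m W *m U) (- (W *m W *m U)) (W *m U).

Lemma rodrigues_curveE U t : rodrigues_curve U t =
  (1%:M + (sin t *: W + (1 - cos t) *: (W *m W))) *m U.
Proof.
rewrite /rodrigues_curve /trig_curve !mulmxDl mul1mx -!scalemxAl.
rewrite scalerBl scale1r scalerN -!addrA; congr (_ + _).
by rewrite addrA addrC.
Qed.

Lemma rodrigues_curve0 U : rodrigues_curve U 0 = U.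
Proof.
by rewrite rodrigues_curveE sin0 cos0 subrr !scale0r !addr0 mul1mx.
Qed.

Lemma is_derive_rodrigues_curve0 U :
  is_derive (0 : R) (1 : R) (rodrigues_curve U) (W *m U).
Proof.
apply: is_derive_eq; first exact: is_derive_trig_curve.
by rewrite /trig_curve cos0 sin0 scale1r scale0r add0r addr0.
Qed.

Hypotheses (W_skew : W^T = - W) (W3 : W *m W *m W = - W).

(** Write the curve as [Q *m U]. Transposing [Q] changes [W] into [- W], and since [W^4 = - W^2] the
    product [Q^T *m Q] collapses to [1 + (1 - cos^2 t - sin^2 t) W^2], which is the identity. *)
Lemma stiefel_rodrigues_curve U t : stiefel U -> stiefel (rodrigues_curve U t).
Proof.
rewrite /stiefel /= => UU; rewrite rodrigues_curveE trmx_mul mulmxA.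
set Q := 1%:M + _; suff QQ : Q^T *m Q = 1%:M.
  by rewrite -(mulmxA U^T) QQ mulmx1.
have trW2 : (W *m W)^T = W *m W by rewrite trmx_mul W_skew mulNmx mulmxN opprK.
have W4 : W *m W *m (W *m W) = - (W *m W) by rewrite mulmxA W3 mulNmx.
have W3' : W *m (W *m W) = - W by rewrite mulmxA.
rewrite /Q !linearD /= !linearZ /= trmx1 W_skew trW2.
rewrite !(mulmxDl, mulmxDr) !(mul1mx, mulmx1).
rewrite -!(scalemxAl, scalemxAr) !(mulNmx, mulmxN) W4 W3 W3'.
apply/matrixP => i j; rewrite !mxE.
set w2 := \sum_k _; set w := W i j; have := cos2Dsin2 t.
move: (cos t) (sin t) => c s cs; apply/eqP; rewrite -subr_eq0.
rewrite (_ : _ - _ = (1 - (c ^+ 2 + s ^+ 2)) * w2); last by ring.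
by rewrite cs subrr mul0r.
Qed.

End Rotation.

Section PlaneRotation.
Variables (R : comNzRingType) (n : nat).

Definition plane_gen (i j : 'I_n) : 'M[R]_n := delta_mx i j - delta_mx j i.

Lemma trmx_plane_gen i j : (plane_gen i j)^T = - plane_gen i j.
Proof. by rewrite /plane_gen linearB /= !trmx_delta opprB. Qed.

(** For distinct [i] and [j] the square is [- (E_ii + E_jj)], minus the projection onto the
    coordinate plane in which the generator acts; for [i = j] the generator is zero. *)
Lemma plane_gen_cube i j :
  plane_gen i j *m plane_gen i j *m plane_gen i j = - plane_gen i j.
Proof.
rewrite /plane_gen; have [->|ij] := eqVneq i j.
  by rewrite subrr !mul0mx oppr0.
have ji : (j == i) = false by rewrite eq_sym (negbTE ij).
rewrite !(mulmxBl, mulmxBr) !mul_delta_mx_cond !eqxx (negbTE ij) ji.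
rewrite !mulr0n !mulr1n !mul0mx.
rewrite !mul_delta_mx_cond !eqxx (negbTE ij) ji !mulr0n !mulr1n.
rewrite !(sub0r, subr0, addr0, add0r, oppr0, opprK, mulNmx, mul0mx).
by rewrite opprB addrC.
Qed.

Lemma mxtrace_mul_delta (M : 'M[R]_n) i j : \tr (M *m delta_mx i j) = M j i.
Proof.
rewrite /mxtrace (bigD1 j) //= big1 ?addr0 => [|k kj]; rewrite mxE.
  rewrite (bigD1 i) //= big1 ?addr0 => [|l li]; rewrite mxE.
    by rewrite !eqxx mulr1.
  by rewrite (negbTE li) mulr0.
by rewrite big1 // => l _; rewrite mxE (negbTE kj) andbF mulr0.
Qed.

(** The trace of [M] against [E_ij - E_ji] is [M j i - M i j]. *)
Lemma trmx_eq_plane_gen (M : 'M[R]_n) :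
  (forall i j, \tr (M *m plane_gen i j) = 0) -> M^T = M.
Proof.
move=> trM; apply/matrixP => i j; have := trM i j.
rewrite mulmxBr linearB /= !mxtrace_mul_delta mxE.
by move/eqP; rewrite subr_eq0 => /eqP.
Qed.

End PlaneRotation.

(** Transposition and cyclicity show that the trace equals its own opposite. *)
Lemma mxtrace_mul_sym_skew (R : numDomainType) n (S K : 'M[R]_n) :
  S^T = S -> K^T = - K -> \tr (S *m K) = 0.
Proof.
move=> S_sym K_skew; suff: \tr (S *m K) *+ 2 = 0.
  by move/eqP; rewrite mulrn_eq0 => /eqP.
rewrite mulr2n -{2}mxtrace_tr trmx_mul S_sym K_skew.
by rewrite mulNmx linearN /= mxtrace_mulC subrr.
Qed.

Lemma stiefel_tangent (R : realType) (n p : nat) (e : R)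
    (g : R -> 'M[R]_(n, p)) (X : 'M[R]_(n, p)) :
  0 < e -> (forall t, `|t| < e -> stiefel (g t)) ->
  is_derive (0 : R) (1 : R) g X -> ((g 0)^T *m X)^T = - ((g 0)^T *m X).
Proof.
move=> e0 gS dg.
have [_ dgg] := is_derive_mulmx (is_derive_trmx dg) dg.
(* The curve is constrained only for [|t| < e], so the product agrees with a constant only near 0,
   which suffices for its derivative at 0 to vanish. *)
have gg1 : \forall t \near (0 : R), cst (1%:M : 'M[R]_p) t = (g t)^T *m g t.
  by near=> t; rewrite [RHS]gS //; near: t; exact: nbhs0_lt.
have [_] := near_eq_is_derive gg1 (is_derive_cst (1%:M : 'M[R]_p) (0 : R) 1).
by rewrite dgg => /eqP; rewrite addr_eq0 trmx_mul trmxK => /eqP.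
Unshelve. all: by end_near. Qed.

Section PenroseCost.
Variables (R : realType) (m n p q : nat).
Variables (A : 'M[R]_(m, n)) (B : 'M[R]_(m, q)) (C : 'M[R]_(p, q)).

Definition penrose_grad (U : 'M[R]_(n, p)) : 'M[R]_(n, p) :=
  A^T *m (A *m U *m C - B) *m C^T.

Lemma frobenius_norm_sq (M : 'M[R]_(m, q)) :
  frobenius_norm M ^+ 2 = \tr (M^T *m M).
Proof.
rewrite /frobenius_norm sqr_sqrtr; last first.
  by apply: sumr_ge0 => i _; apply: sumr_ge0 => j _; exact: sqr_ge0.
rewrite exchange_big; apply: eq_bigr => j _; rewrite mxE.
by apply: eq_bigr => i _; rewrite mxE expr2.
Qed.

Lemma is_derive_penrose_cost (g : R -> 'M[R]_(n, p)) (x : R) X :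
  is_derive x (1 : R) g X ->
  is_derive x (1 : R) (penrose_cost A B C \o g)
    (\tr ((penrose_grad (g x))^T *m X)).
Proof.
move=> dg.
pose r t := A *m g t *m C - B.
have dr : is_derive x (1 : R) r (A *m X *m C).
  have dA := is_derive_mulmx (is_derive_cst A x (1 : R)) dg.
  have dAC := is_derive_mulmx dA (is_derive_cst C x (1 : R)).
  apply: (is_derive_eq (is_deriveB dAC (is_derive_cst B x (1 : R)))).
  by rewrite mul0mx mulmx0 add0r addr0 subr0.
have dtr := is_derive_mxtrace (is_derive_mulmx (is_derive_trmx dr) dr).
rewrite (_ : _ \o _ = 2^-1 \*: (fun t => \tr ((r t)^T *m r t))); last first.
  by apply/funext => t; rewrite /= /penrose_cost frobenius_norm_sq.
apply: (is_derive_eq (is_deriveZ 2^-1 dtr)).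
have -> : \tr ((penrose_grad (g x))^T *m X) = \tr ((r x)^T *m (A *m X *m C)).
  rewrite /penrose_grad -/(r x) !trmx_mul !trmxK -!mulmxA.
  by rewrite mxtrace_mulC -!mulmxA.
(* The two terms of the product rule are transposes of each other, so their traces agree and the
   factor [2^-1] cancels the doubling. *)
rewrite mxtraceD -[\tr (_^T *m r x)]mxtrace_tr [in \tr (_^T)]trmx_mul trmxK.
have two_neq0 : 2 != 0 :> R by rewrite pnatr_eq0.
by rewrite -mulr2n -[RHS](mulKf two_neq0) mulr_natl.
Qed.

Lemma critical_penrose_costP U : stiefel U ->
  critical_point_on (@stiefel R n p) (penrose_cost A B C) U <->
  (penrose_grad U)^T *m U = U^T *m penrose_grad U /\
  (1%:M - U *m U^T) *m penrose_grad U = 0.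
Proof.
set G := penrose_grad U => US; split=> [[_ crit]|[symG projG]].
  have symUG : (U *m G^T)^T = U *m G^T.
    apply: trmx_eq_plane_gen => i j.
    pose W := plane_gen R i j; pose g := rodrigues_curve W U.
    have gS t : `|t| < 1 ->
        stiefel (g t) /\ forall k, derivable (derive1n k g) t 1.
      move=> _; split; last by move=> k; exact: derivable_derive1n_trig_curve.
      apply: stiefel_rodrigues_curve US; first exact: trmx_plane_gen.
      exact: plane_gen_cube.
    have [_ d0] := crit 1 g ltr01 gS (rodrigues_curve0 W U).
    have [_] := is_derive_penrose_cost (is_derive_rodrigues_curve0 W U).
    rewrite rodrigues_curve0 -/G.
    (* Cyclicity turns the vanishing derivative [tr (G^T W U)] into [tr (U G^T W)]. *)
    by rewrite d0 mulmxA mxtrace_mulC mulmxA => <-.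
  (* Multiply [G U^T = U G^T] by [U] on the right. *)
  have GE : G = U *m (G^T *m U).
    by rewrite mulmxA -symUG trmx_mul trmxK -mulmxA US mulmx1.
  have GTU : G^T *m U = U^T *m G by rewrite {2}GE mulmxA US mul1mx.
  split=> //; rewrite mulmxBl mul1mx -mulmxA -GTU -GE; exact: subrr.
split=> // e g e0 gS g0.
have dg : is_derive (0 : R) (1 : R) g ('D_1 g 0).
  by apply: derivableP; have [|_ /(_ 0%N)] := gS 0; rewrite ?normr0.
apply: (is_derive_eq (is_derive_penrose_cost dg)); rewrite g0 -/G.
have skew := stiefel_tangent e0 (fun t te => (gS t te).1) dg.
rewrite g0 in skew; move: projG; rewrite mulmxBl mul1mx.
move=> /eqP; rewrite subr_eq0 -mulmxA => /eqP GE.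
rewrite GE trmx_mul -mulmxA; apply: mxtrace_mul_sym_skew skew.
by rewrite trmxK trmx_mul trmxK symG.
Qed.

End PenroseCost.

Theorem theorem3p5 (R : realType) (m n p q : nat)
    (hp : (1 <= p)%N) (hpn : (p <= n)%N) (hm : (1 <= m)%N) (hq : (1 <= q)%N)
    (A : 'M[R]_(m, n)) (B : 'M[R]_(m, q)) (C : 'M[R]_(p, q))
    (U : 'M[R]_(n, p)) (hU : stiefel U) :
  critical_point_on (@stiefel R n p) (penrose_cost A B C) U <->
  (C *m (A *m U *m C - B)^T *m A *m U \is symmetricmx) /\
  (1%:M - U *m U^T) *m A^T *m (A *m U *m C - B) *m C^T = 0.
Proof.
have symE : (C *m (A *m U *m C - B)^T *m A *m U \is symmetricmx) =
    ((penrose_grad A B C U)^T *m U == U^T *m penrose_grad A B C U).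
  (* [symmetricmx] is the Hermitian condition with sign [(-1)^0] and the identity as conjugation. *)
  rewrite is_hermitianmxE expr0 scale1r map_mx_id // /penrose_grad.
  by rewrite !trmx_mul !trmxK !mulmxA.
have projE : (1%:M - U *m U^T) *m A^T *m (A *m U *m C - B) *m C^T =
    (1%:M - U *m U^T) *m penrose_grad A B C U by rewrite /penrose_grad !mulmxA.
rewrite symE projE (critical_penrose_costP A B C hU).
by split=> -[/eqP ? ?]; split=> //; apply/eqP.
Qed.
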